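(* Let $X$ be a finite set of variables and $Z_1,P_1,Z_2,P_2\subseteq\mathbb{Q}[X]$ finite sets of polynomials. Then \[ \mathrm{alg.cone}_X(\mathit{intersect}(Z_1,P_1,Z_2,P_2)) = \mathrm{alg.cone}_X(Z_1,P_1)\cap\mathrm{alg.cone}_X(Z_2,P_2). \]
   Context: For finite $Z,P \subseteq \mathbb{Q}[V]$, $\mathrm{alg.cone}_V(Z,P) = \langle Z\rangle_V + \mathrm{cone}(P)$ ($\langle Z\rangle_V$ the ideal of $\mathbb{Q}[V]$ generated by $Z$; $\mathrm{cone}(P)$ the non-negative rational combinations of $P$). Let $t \notin X$ be a fresh variable and for a polynomial $f$ and set $S$ write $fS = \{fs : s\in S\}$. Define $\mathit{intersect}(Z_1,P_1,Z_2,P_2) = \mathit{project}_X(tZ_1\cup(1-t)Z_2,\ tP_1\cup(1-t)P_2)$, computed in $\mathbb{Q}[X\cup\{t\}]$. Here, for $X\subseteq Y$ and finite $Z,P\subseteq\mathbb{Q}[Y]$: fix a monomial ordering $\preceq$; the elimination ordering $\preceq_X$ compares monomials $m=m_Xm_{\overline X}$, $n=n_Xn_{\overline X}$ (factored into parts over $X$ and over $Y\setminus X$) by $m\preceq_X n$ iff $m_{\overline X}\prec n_{\overline X}$, or $m_{\overline X}=n_{\overline X}$ and $m_X\preceq n_X$; $\mathit{project}_X(Z,P) = \langle G\cap\mathbb{Q}[X],\ \mathrm{proj}(\{\mathbf{red}_G(p):p\in P\},[X])\rangle$ where $G$ is a Gröbner basis of the ideal generated by $Z$ in $\mathbb{Q}[Y]$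 w.r.t. $\preceq_X$, $\mathbf{red}_G$ is normal form modulo $G$, $[X]$ is the set of monomials over $X$, and $\mathrm{proj}(S,N)$ is a finite set with $\mathrm{cone}(\mathrm{proj}(S,N))=\mathrm{cone}(S)\cap\mathrm{span}_{\mathbb{Q}}(N)$. *)

(* Defs.v *)
From HB Require Import structures.
From mathcomp Require Import all_boot all_order all_algebra.
From mathcomp Require Import finmap.
From mathcomp Require Import mpoly.

Set Implicit Arguments.
Unset Strict Implicit.
Unset Printing Implicit Defensive.

Import GRing.Theory Num.Theory.
Local Open Scope fset_scope.
Local Open Scope ring_scope.

(* All variables live in an ambient finite supply 'I_n; a set of variables is
   V : {set 'I_n}, [V] is [monos V] and Q[V] is the subset [polys V] of
   {mpoly rat[n]}. *)

Definition monos (n : nat) (V : {set 'I_n}) : {pred 'X_{1..n}} :=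
  [pred m : 'X_{1..n} | [forall i, (i \notin V) ==> (m i == 0%N)]].

Definition polys (n : nat) (V : {set 'I_n}) : {pred {mpoly rat[n]}} :=
  [pred p : {mpoly rat[n]} | all (monos V) (msupp p)].

Definition ideal (n : nat) (V : {set 'I_n}) (Z : {fset {mpoly rat[n]}})
    (f : {mpoly rat[n]}) : Prop :=
  exists2 q : {mpoly rat[n]} -> {mpoly rat[n]},
    (forall z, z \in Z -> q z \in polys V) & f = \sum_(z <- Z) q z * z.

Definition cone (n : nat) (P : {fset {mpoly rat[n]}})
    (f : {mpoly rat[n]}) : Prop :=
  exists2 c : {mpoly rat[n]} -> rat,
    (forall p, p \in P -> 0 <= c p) & f = \sum_(p <- P) c p *: p.

Definition alg_cone (n : nat) (V : {set 'I_n}) (Z P : {fset {mpoly rat[n]}})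
    (f : {mpoly rat[n]}) : Prop :=
  exists g h, [/\ ideal V Z g, cone P h & f = g + h].

Definition span (n : nat) (N : {pred 'X_{1..n}}) (f : {mpoly rat[n]}) : Prop :=
  exists (s : seq 'X_{1..n}) (c : 'X_{1..n} -> rat),
    {subset s <= N} /\ f = \sum_(m <- s) c m *: 'X_[m].

Definition monomial_order (n : nat) (Y : {set 'I_n}) (le : rel 'X_{1..n}) :
    Prop :=
  [/\ {in monos Y &, total le},
      {in monos Y &, antisymmetric le},
      {in monos Y & &, transitive le},
      {in monos Y & &, forall m1 m2 m,
         le m1 m2 -> le (m + m1)%MM (m + m2)%MM}
    & forall S : 'X_{1..n} -> Prop,
        (forall m, S m -> m \in monos Y) -> (exists m, S m) ->
        exists2 m, S m & forall m', S m' -> le m m'].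

Definition mpart (n : nat) (V : {set 'I_n}) (m : 'X_{1..n}) : 'X_{1..n} :=
  [multinom (if i \in V then m i else 0%N) | i < n].

Definition elim_order (n : nat) (X Y : {set 'I_n}) (le : rel 'X_{1..n}) :
    rel 'X_{1..n} :=
  fun m1 m2 =>
    let m1' := mpart (Y :\: X) m1 in
    let m2' := mpart (Y :\: X) m2 in
    ((m1' != m2') && le m1' m2')
    || ((m1' == m2') && le (mpart X m1) (mpart X m2)).

(* Only nonzero polynomials have a leading monomial. *)
Definition is_lead (n : nat) (le : rel 'X_{1..n}) (p : {mpoly rat[n]})
    (m : 'X_{1..n}) : Prop :=
  m \in msupp p /\ forall m', m' \in msupp p -> le m' m.

(* (m1 <= m2)%MM is divisibility of monomials. *)
Definition groebner_basis (n : nat) (Y : {set 'I_n}) (le : rel 'X_{1..n})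
    (Z G : {fset {mpoly rat[n]}}) : Prop :=
  (forall g, g \in G -> ideal Y Z g) /\
  (forall f m, ideal Y Z f -> is_lead le f m ->
     exists g mg, [/\ g \in G, is_lead le g mg & (mg <= m)%MM]).

Definition normal_form (n : nat) (Y : {set 'I_n}) (le : rel 'X_{1..n})
    (G : {fset {mpoly rat[n]}}) (p r : {mpoly rat[n]}) : Prop :=
  ideal Y G (p - r) /\
  (forall m g mg, m \in msupp r -> g \in G -> is_lead le g mg ->
     ~~ (mg <= m)%MM).

Definition is_proj (n : nat) (S : {fset {mpoly rat[n]}}) (N : {pred 'X_{1..n}})
    (S' : {fset {mpoly rat[n]}}) : Prop :=
  forall f, cone S' f <-> cone S f /\ span N f.

(* A Groebner basis and the finite generating set returned by proj are not
   unique, so project is the relation between its arguments and any possible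
   output. *)
Definition is_project (n : nat) (le : rel 'X_{1..n}) (X Y : {set 'I_n})
    (Z P : {fset {mpoly rat[n]}})
    (out : {fset {mpoly rat[n]}} * {fset {mpoly rat[n]}}) : Prop :=
  let leX := elim_order X Y le in
  exists (G : {fset {mpoly rat[n]}}) (red : {mpoly rat[n]} -> {mpoly rat[n]}),
    [/\ groebner_basis Y leX Z G,
        forall p, p \in polys Y -> normal_form Y leX G p (red p),
        out.1 = [fset g in G | g \in polys X]
      & is_proj [fset red p | p in P] (monos X) out.2].

Definition scale_fset (n : nat) (f : {mpoly rat[n]})
    (S : {fset {mpoly rat[n]}}) : {fset {mpoly rat[n]}} :=
  [fset f * s | s in S].

Definition is_intersect (n : nat) (le : rel 'X_{1..n}) (X : {set 'I_n})
    (t : 'I_n) (Z1 P1 Z2 P2 : {fset {mpoly rat[n]}})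
    (out : {fset {mpoly rat[n]}} * {fset {mpoly rat[n]}}) : Prop :=
  is_project le X (t |: X)%SET
    (scale_fset 'X_t Z1 `|` scale_fset (1 - 'X_t) Z2)
    (scale_fset 'X_t P1 `|` scale_fset (1 - 'X_t) P2)
    out.

(* Main.v *)
Require Import Defs.
From HB Require Import structures.
From mathcomp Require Import all_boot all_order all_algebra.
From mathcomp Require Import finmap.
From mathcomp Require Import mpoly.
From Stdlib Require Import Classical_Prop.

(** Write [Y] for [X] with [t] added.  Projection computes the polynomials of
    [Q[X]] that lie in an algebraic cone over [Y]: if [f = g + h] lies in
    [Q[X]], with [g] in the ideal and [h] a non-negative combination of normal
    forms, then a leading monomial of [g] outside [[X]] would occur in [h],
    although it is divisible by the leading monomial of an element of the
    Groebner basis.  Hence [g] lies in [Q[X]], and in the elimination ideal.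
    For the intersection, the substitutions [t := 1] and [t := 0] send the cone
    over [Y] to each of the two given cones and fix [Q[X]]; conversely [f] in
    both cones is recovered from [f = t f + (1 - t) f]. *)

Set Implicit Arguments.
Unset Strict Implicit.
Unset Printing Implicit Defensive.

Lemma seq_has_max (T : eqType) (le : rel T) (s : seq T) :
  {in s &, total le} -> {in s & &, transitive le} -> s != [::] ->
  exists2 m, m \in s & forall m', m' \in s -> le m' m.
Proof.
elim: s => // x s IH le_total le_trans _.
have sub y : y \in s -> y \in x :: s by rewrite inE orbC => ->.
have xx : x \in x :: s by rewrite inE eqxx.
have le_refl : le x x by have := le_total x x xx xx; rewrite orbb.
have [->|s_neq0] := eqVneq s [::].
  by exists x; rewrite ?inE // => y; rewrite inE => /eqP ->.
have [||m ms m_max] := IH _ _ s_neq0.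
- by move=> y z /sub ys /sub zs; exact: le_total.
- by move=> y z w /sub ys /sub zs /sub ws; exact: le_trans.
have [xm|mx] := orP (le_total x m xx (sub _ ms)).
  by exists m => [|y]; [exact: sub|rewrite inE => /predU1P[->|/m_max]].
exists x => // y; rewrite inE => /predU1P[->//|ys].
exact: le_trans (sub _ ms) (sub _ ys) xx (m_max _ ys) mx.
Qed.

Section AlgebraicCones.
Import GRing.Theory Num.Theory.
Local Open Scope fset_scope.
Local Open Scope ring_scope.
Variable n : nat.
Implicit Types (V W X Y : {set 'I_n}) (t : 'I_n) (m k : 'X_{1..n}).
Implicit Types (p q f g h u v : {mpoly rat[n]}).
Implicit Types (Z P G Q : {fset {mpoly rat[n]}}) (le : rel 'X_{1..n}).

Lemma monosP V m : reflect (forall i, i \notin V -> m i = 0%N) (m \in monos V).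
Proof.
apply: (iffP forallP) => mV i; last by apply/implyP => /mV ->.
by move=> iV; apply/eqP; move: (mV i); rewrite iV.
Qed.

Lemma monosS V W : V \subset W -> {subset monos V <= monos W}.
Proof.
move=> sVW m /monosP mV; apply/monosP => i iW; apply: mV.
by apply: contra iW; apply/subsetP.
Qed.

Lemma monos0 V : 0%MM \in monos V.
Proof. by apply/monosP => i _; rewrite mnm0E. Qed.

Lemma monosD V m1 m2 :
  m1 \in monos V -> m2 \in monos V -> (m1 + m2)%MM \in monos V.
Proof.
by move=> /monosP m1V /monosP m2V; apply/monosP => i iV; rewrite mnmDE m1V ?m2V.
Qed.

Lemma monos_dvd V m1 m2 : (m1 <= m2)%MM -> m2 \in monos V -> m1 \in monos V.
Proof.
move=> /mnm_lepP dvd /monosP m2V; apply/monosP => i iV.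
by apply/eqP; rewrite -leqn0 -(m2V _ iV).
Qed.

Lemma monosB V m1 m2 : m1 \in monos V -> (m1 - m2)%MM \in monos V.
Proof.
by apply: monos_dvd; apply/mnm_lepP => i; rewrite mnmBE leq_subr.
Qed.

Lemma monosU V i : (U_(i)%MM \in monos V) = (i \in V).
Proof.
apply/monosP/idP => [UV|iV j jV]; last first.
  by rewrite mnm1E; case: eqVneq jV => // <-; rewrite iV.
by apply: contraT => /UV; rewrite mnm1E eqxx.
Qed.

Lemma mpart_monos V W m : m \in monos W -> mpart V m \in monos W.
Proof.
by move=> /monosP mW; apply/monosP => i iW; rewrite mnmE mW // if_same.
Qed.

Lemma mpartD V m1 m2 : mpart V (m1 + m2)%MM = (mpart V m1 + mpart V m2)%MM.
Proof. by apply/mnmP => i; rewrite mnmDE !mnmE; case: ifP. Qed.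

Lemma mpart_setD_eq0 X Y m : m \in monos Y ->
  (mpart (Y :\: X) m == 0%MM) = (m \in monos X).
Proof.
move=> /monosP mY; apply/eqP/monosP => [/mnmP m0 i iX|mX].
  move: (m0 i); rewrite mnmE mnm0E inE iX /=; case: ifPn => // iY _.
  exact: mY.
by apply/mnmP => i; rewrite mnmE mnm0E inE; case: ifP => // /andP[/mX].
Qed.

Lemma mpart_setD_inj X Y : {in monos Y &, forall m1 m2,
  mpart X m1 = mpart X m2 -> mpart (Y :\: X) m1 = mpart (Y :\: X) m2 ->
  m1 = m2}.
Proof.
move=> m1 m2 /monosP m1Y /monosP m2Y /mnmP eqX /mnmP eqYX; apply/mnmP => i.
move: (eqX i) (eqYX i); rewrite !mnmE inE.
by case: ifP => //= _ _; case: ifPn => // iY _; rewrite m1Y ?m2Y.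
Qed.

Lemma polysP V p :
  reflect (forall m, m \in msupp p -> m \in monos V) (p \in polys V).
Proof. exact: allP. Qed.

Lemma polys_subalg V : subalg_closed (polys V).
Proof.
split=> [|c p q /polysP pV /polysP qV|p q /polysP pV /polysP qV];
    apply/polysP => m.
- by rewrite msupp1 inE => /eqP ->; exact: monos0.
- by move/msuppD_le; rewrite mem_cat => /orP[/msuppZ_le/pV|/qV].
- move/msuppM_le => /allpairsP[[m1 m2] /= [/pV m1V /qV m2V ->]].
  exact: monosD.
Qed.

HB.instance Definition _ V :=
  GRing.isSubalgClosed.Build rat {mpoly rat[n]} (polys V) (polys_subalg V).

Lemma polysS V W : V \subset W -> {subset polys V <= polys W}.
Proof.
by move=> sVW p /polysP pV; apply/polysP => m /pV; exact: monosS.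
Qed.

Lemma mpolyX_polys V m : ('X_[m] \in polys V) = (m \in monos V).
Proof.
apply/polysP/idP => [|mV k]; last by rewrite msuppX inE => /eqP ->.
by apply; rewrite msuppX inE.
Qed.

Lemma span_monosP V f : Defs.span (monos V) f <-> f \in polys V.
Proof.
split=> [[s [c [sV ->]]]|/polysP fV].
  rewrite big_seq; apply: rpred_sum => m /sV mV.
  by rewrite rpredZ // mpolyX_polys.
by exists (msupp f), (fun m => f@_m); split => //; exact: mpolyE.
Qed.

Lemma ideal_ind V Z (K : {mpoly rat[n]} -> Prop) :
  K 0 -> (forall f g, K f -> K g -> K (f + g)) ->
  (forall q z, q \in polys V -> z \in Z -> K (q * z)) ->
  forall f, ideal V Z f -> K f.
Proof.
move=> K0 KD KM f [q qV ->]; rewrite big_seq.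
by apply: big_ind => // z zZ; auto.
Qed.

Lemma ideal0 V Z : ideal V Z 0.
Proof.
exists (fun=> 0); first by move=> z _; exact: rpred0.
by rewrite big1 // => z _; rewrite mul0r.
Qed.

Lemma idealD V Z f g : ideal V Z f -> ideal V Z g -> ideal V Z (f + g).
Proof.
move=> [q qV ->] [r rV ->]; exists (fun z => q z + r z).
  by move=> z zZ; apply: rpredD; auto.
by rewrite -big_split; apply: eq_bigr => z _; rewrite mulrDl.
Qed.

Lemma idealM V Z q f : q \in polys V -> ideal V Z f -> ideal V Z (q * f).
Proof.
move=> qV [r rV ->]; exists (fun z => q * r z).
  by move=> z zZ; apply: rpredM; auto.
by rewrite big_distrr; apply: eq_bigr => z _; rewrite /= mulrA.
Qed.

Lemma idealN V Z f : ideal V Z f -> ideal V Z (- f).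
Proof. by rewrite -mulN1r; apply: idealM; rewrite rpredN rpred1. Qed.

Lemma ideal_gen V Z z : z \in Z -> ideal V Z z.
Proof.
move=> zZ; exists (fun y => (y == z)%:R).
  by move=> y _; case: (y == z); [exact: rpred1|exact: rpred0].
rewrite (bigD1_seq z) //= eqxx mul1r big1 ?addr0 // => y /negPf ->.
by rewrite mul0r.
Qed.

Lemma ideal_polys V Z f : {subset Z <= polys V} -> ideal V Z f -> f \in polys V.
Proof.
move=> ZV [q qV ->]; rewrite big_seq; apply: rpred_sum => z zZ.
by apply: rpredM; auto.
Qed.

Lemma cone_ind P (K : {mpoly rat[n]} -> Prop) :
  K 0 -> (forall f g, K f -> K g -> K (f + g)) ->
  (forall c p, 0 <= c -> p \in P -> K (c *: p)) ->
  forall f, cone P f -> K f.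
Proof.
move=> K0 KD KZ f [c c0 ->]; rewrite big_seq.
by apply: big_ind => // z zZ; auto.
Qed.

Lemma cone0 P : cone P 0.
Proof. by exists (fun=> 0) => //; rewrite big1 // => z _; rewrite scale0r. Qed.

Lemma coneD P f g : cone P f -> cone P g -> cone P (f + g).
Proof.
move=> [c c0 ->] [d d0 ->]; exists (fun p => c p + d p).
  by move=> p pP; apply: addr_ge0; auto.
by rewrite -big_split; apply: eq_bigr => p _; rewrite scalerDl.
Qed.

Lemma coneZ P (c : rat) f : 0 <= c -> cone P f -> cone P (c *: f).
Proof.
move=> c0 [d d0 ->]; exists (fun p => c * d p).
  by move=> p pP; apply: mulr_ge0; auto.
by rewrite scaler_sumr; apply: eq_bigr => p _; rewrite scalerA.
Qed.

Lemma cone_gen P p : p \in P -> cone P p.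
Proof.
move=> pP; exists (fun y => (y == p)%:R) => [y _|]; first exact: ler0n.
rewrite (bigD1_seq p) ?fset_uniq //= eqxx scale1r big1 ?addr0 // => y /negPf ->.
by rewrite scale0r.
Qed.

Lemma cone_polys V P f : {subset P <= polys V} -> cone P f -> f \in polys V.
Proof.
move=> PV [c _ ->]; rewrite big_seq; apply: rpred_sum => p pP.
by apply: rpredZ; exact: PV.
Qed.

Lemma ideal_alg_cone V Z P f : ideal V Z f -> alg_cone V Z P f.
Proof. by exists f, 0; split; rewrite ?addr0 //; exact: cone0. Qed.

Lemma cone_alg_cone V Z P f : cone P f -> alg_cone V Z P f.
Proof. by exists 0, f; split; rewrite ?add0r //; exact: ideal0. Qed.

Lemma alg_coneD V Z P f g :
  alg_cone V Z P f -> alg_cone V Z P g -> alg_cone V Z P (f + g).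
Proof.
move=> [a [b [aI bC ->]]] [c [d [cI dC ->]]]; exists (a + c), (b + d).
by split; [exact: idealD|exact: coneD|rewrite addrACA].
Qed.

Lemma alg_coneZ V Z P (c : rat) f :
  0 <= c -> alg_cone V Z P f -> alg_cone V Z P (c *: f).
Proof.
move=> c0 [g [h [gI hC ->]]]; exists (c *: g), (c *: h).
split; [|exact: coneZ|exact: scalerDr].
by rewrite -mulr_algl; apply: idealM => //; rewrite rpredZ // rpred1.
Qed.

Lemma alg_cone_polys V Z P f : {subset Z <= polys V} -> {subset P <= polys V} ->
  alg_cone V Z P f -> f \in polys V.
Proof.
move=> ZV PV [g [h [gI hC ->]]]; apply: rpredD; first exact: ideal_polys gI.
exact: cone_polys hC.
Qed.

Section SemilinearImage.
Variables (V W : {set 'I_n}) (psi : {mpoly rat[n]} -> {mpoly rat[n]}).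
Variable phi : {linear {mpoly rat[n]} -> {mpoly rat[n]}}.
Hypothesis psi_polys : forall q, q \in polys V -> psi q \in polys W.
Hypothesis phiM : forall q f, phi (q * f) = psi q * phi f.

Lemma ideal_image Z Z' : (forall z, z \in Z -> ideal W Z' (phi z)) ->
  forall f, ideal V Z f -> ideal W Z' (phi f).
Proof.
move=> ZZ'; apply: ideal_ind => [|f g fI gI|q z /psi_polys qW /ZZ' zI].
- by rewrite linear0; exact: ideal0.
- by rewrite linearD; exact: idealD.
- by rewrite phiM; exact: idealM.
Qed.

Lemma alg_cone_image Z P Z' P' : (forall z, z \in Z -> ideal W Z' (phi z)) ->
  (forall p, p \in P -> alg_cone W Z' P' (phi p)) ->
  forall f, alg_cone V Z P f -> alg_cone W Z' P' (phi f).
Proof.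
move=> ZZ' PP' f [g [h [gI hC ->]]]; rewrite linearD; apply: alg_coneD.
  exact/ideal_alg_cone/(ideal_image ZZ').
move: h hC; apply: cone_ind => [|a b aC bC|c p c0 /PP' pC].
- by rewrite linear0; exact/cone_alg_cone/cone0.
- by rewrite linearD; exact: alg_coneD.
- by rewrite linearZ; exact: alg_coneZ.
Qed.

End SemilinearImage.

Lemma ideal_sub V W Z Z' f : V \subset W ->
  (forall z, z \in Z -> ideal W Z' z) ->
  ideal V Z f -> ideal W Z' f.
Proof.
move=> /polysS sVW ZZ'; exact: (ideal_image (psi := id) (phi := idfun) sVW).
Qed.

Lemma alg_cone_sub V W Z P Z' P' f : V \subset W ->
  (forall z, z \in Z -> ideal W Z' z) ->
  (forall p, p \in P -> alg_cone W Z' P' p) ->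
  alg_cone V Z P f -> alg_cone W Z' P' f.
Proof.
move=> /polysS sVW ZZ' PP'.
exact: (alg_cone_image (psi := id) (phi := idfun) sVW).
Qed.

Section MonomialOrder.
Variables (Y : {set 'I_n}) (le : rel 'X_{1..n}).
Hypothesis leP : monomial_order Y le.

Let le_total : {in monos Y &, total le}. Proof. by case: leP. Qed.
Let le_trans : {in monos Y & &, transitive le}. Proof. by case: leP. Qed.
Let le_add : {in monos Y & &, forall m1 m2 m,
  le m1 m2 -> le (m + m1)%MM (m + m2)%MM}.
Proof. by case: leP. Qed.

Lemma monomial_order_anti : {in monos Y &, forall m1 m2,
  le m1 m2 -> le m2 m1 -> m1 = m2}.
Proof.
case: leP => _ anti _ _ _ m1 m2 m1Y m2Y le12 le21.
by apply: anti => //; apply/andP.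
Qed.

Lemma monomial_order_ge0 m : m \in monos Y -> le 0%MM m.
Proof.
case: leP => _ _ _ _ /(_ (fun k => k \in monos Y))[//||m0 m0Y m0_min].
  by exists 0%MM; exact: monos0.
suff <- : m0 = 0%MM by exact: m0_min.
have m00Y := monosD m0Y m0Y.
have le00 : le (m0 + m0)%MM m0.
  by rewrite -{3}[m0]addm0; apply: le_add; rewrite ?monos0 ?m0_min ?monos0.
have /mnmP eq00 := monomial_order_anti m00Y m0Y le00 (m0_min _ m00Y).
apply/mnmP => i; move: (eq00 i); rewrite mnmDE mnm0E.
by rewrite -{3}[m0 i]addn0 => /addnI.
Qed.

Lemma is_lead_exists p : p \in polys Y -> p != 0 -> exists m, is_lead le p m.
Proof.
move=> /polysP pY; rewrite -msupp_eq0.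
move=> /(seq_has_max (le := le))[||m]; last by exists m.
- by move=> m1 m2 /pY m1Y /pY; exact: le_total.
- by move=> m1 m2 m3 /pY m1Y /pY m2Y /pY; exact: le_trans.
Qed.

Definition msupp_below m p : Prop :=
  forall m', m' \in msupp p -> le m' m /\ m' != m.

Lemma lead_ind (K : {mpoly rat[n]} -> Prop) :
  K 0 ->
  (forall f m, f \in polys Y -> is_lead le f m ->
     (forall g, g \in polys Y -> msupp_below m g -> K g) -> K f) ->
  forall f, f \in polys Y -> K f.
Proof.
move=> K0 Kstep f fY; apply: NNPP => notKf.
have bad_lead g : g \in polys Y -> ~ K g -> exists m, is_lead le g m.
  move=> gY notKg; apply: is_lead_exists => //.
  by apply/eqP => g0; rewrite g0 in notKg.
pose bad m := exists g, [/\ g \in polys Y, is_lead le g m & ~ K g].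
have bad_monos m : bad m -> m \in monos Y.
  by move=> [g [/polysP gY [mg _] _]]; exact: gY.
case: leP => _ _ _ _ /(_ bad bad_monos)[|m badm m_min].
  by have [m fm] := bad_lead f fY notKf; exists m, f.
have [g [gY gm notKg]] := badm; apply: notKg.
apply: Kstep gY gm _ => h hY hm; apply: NNPP => notKh.
have [k hk] := bad_lead h hY notKh; have badk : bad k by exists h.
have [km /eqP] := hm k (proj1 hk); apply.
by apply: monomial_order_anti (m_min _ badk); rewrite ?bad_monos.
Qed.

Definition lead_reduct f m g k : {mpoly rat[n]} :=
  f - (f@_m / g@_k) *: 'X_[m - k] * g.

Lemma lead_reduct_below f m g k : f \in polys Y -> g \in polys Y ->
  is_lead le f m -> is_lead le g k -> (k <= m)%MM ->
  msupp_below m (lead_reduct f m g k).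
Proof.
move=> /polysP fY /polysP gY [mf f_max] [kg g_max] dvd m' m'r.
have mY := fY _ mf; have kY := gY _ kg.
have coef_m : (lead_reduct f m g k)@_m = 0.
  have := mcoeffMX g (m - k) k; rewrite submK // mulrC => Xg.
  rewrite mcoeffB -scalerAl mcoeffZ Xg mulfVK ?subrr //.
  by rewrite mcoeff_msupp in kg.
split; last by apply: contraTneq m'r => ->; rewrite mcoeff_msupp coef_m eqxx.
move: m'r => /msuppD_le; rewrite mem_cat => /orP[/f_max //|].
rewrite (perm_mem (msuppN _)) -scalerAl => /msuppZ_le.
rewrite mulrC (perm_mem (msuppMX _ _)) => /mapP[k' k'g ->].
rewrite -{2}(submK dvd); apply: le_add; [exact: gY|by []|exact: monosB|].
exact: g_max.
Qed.

End MonomialOrder.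

Section ElimOrder.
Variables (X Y : {set 'I_n}) (le : rel 'X_{1..n}).
Hypothesis leP : monomial_order Y le.

Local Notation leX := (elim_order X Y le).

Let le_total : {in monos Y &, total le}. Proof. by case: leP. Qed.
Let le_trans : {in monos Y & &, transitive le}. Proof. by case: leP. Qed.

Lemma elim_orderE m1 m2 : leX m1 m2 =
  if mpart (Y :\: X) m1 == mpart (Y :\: X) m2 then le (mpart X m1) (mpart X m2)
  else le (mpart (Y :\: X) m1) (mpart (Y :\: X) m2).
Proof. by rewrite /elim_order; case: eqVneq; rewrite //= orbF. Qed.

Lemma elim_order_total : {in monos Y &, total leX}.
Proof.
move=> m1 m2 m1Y m2Y; rewrite !elim_orderE eq_sym.
by case: eqVneq => _; apply: le_total; exact: mpart_monos.
Qed.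

Lemma elim_order_anti : {in monos Y &, antisymmetric leX}.
Proof.
move=> m1 m2 m1Y m2Y; rewrite !elim_orderE eq_sym.
have pY V := (mpart_monos V m1Y, mpart_monos V m2Y).
case: eqVneq => [eqYX|/eqP neYX] /andP[le12 le21].
  apply: (mpart_setD_inj (X := X) m1Y m2Y _ (esym eqYX)).
  by apply: (monomial_order_anti leP) le12 le21; rewrite pY.
by case: neYX; apply: (monomial_order_anti leP) le21 le12; rewrite pY.
Qed.

Lemma elim_order_trans : {in monos Y & &, transitive leX}.
Proof.
move=> m2 m1 m3 m2Y m1Y m3Y; rewrite !elim_orderE.
have pY V := (mpart_monos V m1Y, mpart_monos V m2Y, mpart_monos V m3Y).
have [->|ne12] := eqVneq (mpart (Y :\: X) m1).
  by case: eqVneq => // _; apply: le_trans; rewrite pY.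
have [<-|ne23] := eqVneq (mpart (Y :\: X) m2); first by rewrite (negPf ne12).
move=> le12 le23; case: eqVneq => [eq13|_].
  case/eqP: ne12; apply: (monomial_order_anti leP) le12 _; rewrite ?pY //.
  by rewrite eq13.
by apply: le_trans le12 le23; rewrite pY.
Qed.

Lemma elim_order_add : {in monos Y & &, forall m1 m2 m,
  leX m1 m2 -> leX (m + m1)%MM (m + m2)%MM}.
Proof.
case: leP => _ _ _ le_add _ m1 m2 m m1Y m2Y mY.
rewrite !elim_orderE !mpartD eqm_add2l.
by case: ifP => _; apply: le_add; exact: mpart_monos.
Qed.

Lemma elim_order_wf (S : 'X_{1..n} -> Prop) :
  (forall m, S m -> m \in monos Y) -> (exists m, S m) ->
  exists2 m, S m & forall m', S m' -> leX m m'.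
Proof.
case: leP => _ _ _ _ wf SY [m0 Sm0].
have [l [m1]||k [m1 Sm1 k_part] k_min] :=
  wf (fun k => exists2 m, S m & mpart (Y :\: X) m = k).
- by move=> /SY m1Y <-; exact: mpart_monos.
- by exists (mpart (Y :\: X) m0), m0.
have [l [m2 [/SY m2Y _ <-]]||l [m2 [Sm2 m2_part <-]] m2_min] :=
  wf (fun l => exists m, [/\ S m, mpart (Y :\: X) m = k & mpart X m = l]).
- exact: mpart_monos.
- by exists (mpart X m1), m1.
exists m2 => // m Sm; rewrite elim_orderE m2_part.
case: eqVneq => [k_eq|_]; first by apply: m2_min; exists m.
by apply: k_min; exists m.
Qed.

Lemma elim_order_monomial_order : monomial_order Y leX.
Proof.
split; [exact: elim_order_total|exact: elim_order_anti|exact: elim_order_trans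
       |exact: elim_order_add|exact: elim_order_wf].
Qed.

End ElimOrder.

Definition eliminates X Y le : Prop :=
  forall m1 m2, m1 \in monos Y -> m2 \in monos X -> le m1 m2 -> m1 \in monos X.

Lemma elim_order_eliminates X Y le : X \subset Y -> monomial_order Y le ->
  eliminates X Y (elim_order X Y le).
Proof.
move=> sXY leP m1 m2 m1Y m2X; have m2Y := monosS sXY m2X.
have /eqP m2_part : mpart (Y :\: X) m2 == 0%MM by rewrite mpart_setD_eq0.
rewrite elim_orderE m2_part -(mpart_setD_eq0 X m1Y).
case: eqVneq => // ne0 le0; case/eqP: ne0.
have m1YX := mpart_monos (Y :\: X) m1Y.
apply: (monomial_order_anti leP) le0 _ => //; first exact: monos0.
exact: monomial_order_ge0 leP _ m1YX.
Qed.

Definition reduced le G (r : {mpoly rat[n]}) : Prop := forall m g k,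
  m \in msupp r -> g \in G -> is_lead le g k -> ~~ (k <= m)%MM.

Lemma cone_reduced le G Q h : (forall q, q \in Q -> reduced le G q) ->
  cone Q h -> reduced le G h.
Proof.
move=> Qred; move: h.
apply: cone_ind => [|a b ared bred|c q _ /Qred qred] m g k.
- by rewrite msupp0.
- by move=> /msuppD_le; rewrite mem_cat => /orP[/ared|/bred]; exact.
- by move=> /msuppZ_le; exact: qred.
Qed.

Section Elimination.
Variables (X Y : {set 'I_n}) (le : rel 'X_{1..n}) (Z G : {fset {mpoly rat[n]}}).
Hypotheses (sXY : X \subset Y) (leP : monomial_order Y le).
Hypothesis le_elim : eliminates X Y le.
Hypotheses (ZY : {subset Z <= polys Y}) (GB : groebner_basis Y le Z G).

Lemma lead_monos_polys f m :
  f \in polys Y -> is_lead le f m -> m \in monos X -> f \in polys X.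
Proof.
move=> /polysP fY [_ f_max] mX; apply/polysP => k kf.
exact: le_elim (fY _ kf) mX (f_max _ kf).
Qed.

Lemma groebner_elimination_ideal f : ideal Y Z f -> f \in polys X ->
  ideal X [fset g in G | g \in polys X] f.
Proof.
have [GZ G_lead] := GB.
move=> fI fX; have fY := polysS sXY fX; move: f fY fI fX.
apply: (lead_ind leP) => [_ _|f m fY fm IH fI fX]; first exact: ideal0.
have mX : m \in monos X by apply: (polysP _ _ fX); case: fm.
have [g [k [gG gk dvd]]] := G_lead f m fI fm.
have gY := ideal_polys ZY (GZ _ gG).
have gX := lead_monos_polys gY gk (monos_dvd dvd mX).
set r := (f@_m / g@_k) *: 'X_[m - k].
have rX : r \in polys X by rewrite rpredZ // mpolyX_polys monosB.
have fE : f = lead_reduct f m g k + r * g by rewrite subrK.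
have redX : lead_reduct f m g k \in polys X by rewrite rpredB // rpredM.
rewrite fE; apply: idealD; last first.
  by apply: idealM => //; apply: ideal_gen; rewrite !inE gG.
apply: IH => //.
- exact: polysS redX.
- exact: (lead_reduct_below leP).
- by apply/idealD/idealN/idealM/GZ => //; exact: polysS rX.
Qed.

Lemma ideal_polys_of_reduced g h : ideal Y Z g -> reduced le G h ->
  g + h \in polys X -> g \in polys X.
Proof.
move=> gI hred ghX; have [->|g_neq0] := eqVneq g 0; first exact: rpred0.
have gY := ideal_polys ZY gI.
have [m gm] := is_lead_exists leP gY g_neq0.
have [g' [k [g'G g'k dvd]]] := proj2 GB _ _ gI gm.
apply: (lead_monos_polys gY gm); apply: (polysP _ _ ghX).
have mh : m \notin msupp h by apply/negP => /hred/(_ g'G g'k); rewrite dvd.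
rewrite mcoeff_msupp mcoeffD (memN_msupp_eq0 mh) addr0 -mcoeff_msupp.
by case: gm.
Qed.

Lemma alg_cone_elimination Q Q' f : (forall q, q \in Q -> reduced le G q) ->
  is_proj Q (monos X) Q' ->
  alg_cone X [fset g in G | g \in polys X] Q' f <->
  alg_cone Y Z Q f /\ f \in polys X.
Proof.
move=> Qred Q'P; split=> [[g [h [gI /Q'P[hC /span_monosP hX] ->]]]|].
  split; last first.
    by rewrite rpredD // (ideal_polys _ gI) // => z; rewrite !inE => /andP[].
  exists g, h; split=> //; apply: ideal_sub gI => // z.
  by rewrite !inE => /andP[/(proj1 GB)].
move=> [[g [h [gI hC ->]]] ghX].
have gX := ideal_polys_of_reduced gI (cone_reduced Qred hC) ghX.
exists g, h; split=> //; first exact: groebner_elimination_ideal.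
by apply/Q'P; split=> //; apply/span_monosP; rewrite -(rpredDl _ gX).
Qed.

End Elimination.

Lemma alg_cone_normal_form Y le Z G P
    (red : {mpoly rat[n]} -> {mpoly rat[n]}) f :
  groebner_basis Y le Z G ->
  (forall p, p \in P -> normal_form Y le G p (red p)) ->
  alg_cone Y Z [fset red p | p in P] f <-> alg_cone Y Z P f.
Proof.
move=> [GZ _] redP.
have sub_red p : p \in P -> ideal Y Z (p - red p).
  by move=> /redP[+ _]; exact: ideal_sub.
split; apply: alg_cone_sub => //; try exact: ideal_gen.
- move=> _ /imfsetP[p /= pP ->]; rewrite -(subKr p (red p)).
  apply: alg_coneD; first exact/cone_alg_cone/cone_gen.
  exact/ideal_alg_cone/idealN/sub_red.
- move=> p pP; rewrite -(subrK (red p) p).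
  apply: alg_coneD; first exact/ideal_alg_cone/sub_red.
  by apply/cone_alg_cone/cone_gen/imfsetP; exists p.
Qed.

Lemma project_alg_cone X Y le Z P out f : X \subset Y -> monomial_order Y le ->
  {subset Z <= polys Y} -> {subset P <= polys Y} -> is_project le X Y Z P out ->
  alg_cone X out.1 out.2 f <-> alg_cone Y Z P f /\ f \in polys X.
Proof.
move=> sXY leP ZY PY [G [red [GB redP -> outP]]].
have redPP p : p \in P -> normal_form Y (elim_order X Y le) G p (red p).
  by move=> /PY; exact: redP.
rewrite -(alg_cone_normal_form f GB redPP).
have leXP := elim_order_monomial_order X leP.
have leX_elim := elim_order_eliminates sXY leP.
apply: (alg_cone_elimination sXY leXP leX_elim ZY GB _ _ outP).
by move=> _ /imfsetP[p /= /redPP[_ rp] ->].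
Qed.

Section Substitution.
Variables (X : {set 'I_n}) (t : 'I_n) (q : {mpoly rat[n]}).

Definition subst_var : n.-tuple {mpoly rat[n]} :=
  [tuple (if i == t then q else 'X_i) | i < n].

Lemma subst_varX : 'X_t \mPo subst_var = q.
Proof. by rewrite comp_mpolyXU -tnth_nth tnth_mktuple eqxx. Qed.

Lemma subst_var_id p : t \notin X -> p \in polys X -> p \mPo subst_var = p.
Proof.
move=> tX /polysP pX; rewrite comp_mpolyE [RHS]mpolyE.
apply: eq_big_seq => m /pX /monosP mX; congr (_ *: _).
rewrite mpolyXE_id; apply: eq_bigr => i _; rewrite tnth_mktuple.
by case: eqVneq => // ->; rewrite mX // !expr0.
Qed.

Lemma subst_var_polys p : q \in polys X -> p \in polys (t |: X)%SET ->
  p \mPo subst_var \in polys X.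
Proof.
move=> qX /polysP pX; rewrite comp_mpolyE big_seq.
apply: rpred_sum => m /pX /monosP mX; apply: rpredZ; apply: rpred_prod => i _.
rewrite tnth_mktuple; case: eqVneq => [_|it]; first exact: rpredX.
have [iX|iX] := boolP (i \in X); first by rewrite rpredX // mpolyX_polys monosU.
by rewrite mX ?expr0 ?rpred1 // !inE negb_or it.
Qed.

End Substitution.

Lemma mem_scale_fsetU u v Z Z' p :
  p \in scale_fset u Z `|` scale_fset v Z' ->
  (exists2 z, z \in Z & p = u * z) \/ (exists2 z, z \in Z' & p = v * z).
Proof.
by rewrite inE => /orP[/imfsetP[z /= zZ ->]|/imfsetP[z /= zZ ->]]; [left|right];
  exists z.
Qed.

Lemma scale_fsetU_polys V u v Z Z' : u \in polys V -> v \in polys V ->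
  {subset Z <= polys V} -> {subset Z' <= polys V} ->
  {subset scale_fset u Z `|` scale_fset v Z' <= polys V}.
Proof.
move=> uV vV ZV Z'V p /mem_scale_fsetU[][z zZ ->]; apply: rpredM => //.
- exact: ZV.
- exact: Z'V.
Qed.

Lemma alg_cone_scale_fset V W u Z P Z' P' f : V \subset W ->
  {subset scale_fset u Z <= Z'} -> {subset scale_fset u P <= P'} ->
  alg_cone V Z P f -> alg_cone W Z' P' (u * f).
Proof.
move=> /polysS sVW ZZ' PP'.
apply: (alg_cone_image (phi := u \*o idfun) sVW) => [q g|z zZ|p pP] /=.
- by rewrite mulrCA.
- by apply: ideal_gen; apply: ZZ'; apply/imfsetP; exists z.
- by apply/cone_alg_cone/cone_gen; apply: PP'; apply/imfsetP; exists p.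
Qed.

Lemma alg_cone_subst_var X t q u v Z1 P1 Z2 P2 f :
  t \notin X -> q \in polys X ->
  {subset Z1 <= polys X} -> {subset P1 <= polys X} ->
  u \mPo subst_var t q = 1 -> v \mPo subst_var t q = 0 -> f \in polys X ->
  alg_cone (t |: X)%SET (scale_fset u Z1 `|` scale_fset v Z2)
    (scale_fset u P1 `|` scale_fset v P2) f ->
  alg_cone X Z1 P1 f.
Proof.
move=> tX qX Z1X P1X u1 v0 fX fC; rewrite -(subst_var_id q tX fX).
pose subst := comp_mpoly (subst_var t q).
move: fC; apply: (alg_cone_image (phi := subst) (psi := subst)).
- by move=> p; exact: subst_var_polys.
- exact: rmorphM.
- move=> _ /mem_scale_fsetU[][z zZ ->]; rewrite rmorphM /= ?u1 ?v0.
    by rewrite mul1r (subst_var_id _ tX) ?Z1X //; exact: ideal_gen.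
  by rewrite mul0r; exact: ideal0.
- move=> _ /mem_scale_fsetU[][p pP ->]; rewrite rmorphM /= ?u1 ?v0.
    by rewrite mul1r (subst_var_id _ tX) ?P1X //; exact/cone_alg_cone/cone_gen.
  by rewrite mul0r; exact/cone_alg_cone/cone0.
Qed.

Lemma alg_cone_intersect X t Z1 P1 Z2 P2 f : t \notin X ->
  {subset Z1 <= polys X} -> {subset P1 <= polys X} ->
  {subset Z2 <= polys X} -> {subset P2 <= polys X} ->
  alg_cone (t |: X)%SET (scale_fset 'X_t Z1 `|` scale_fset (1 - 'X_t) Z2)
    (scale_fset 'X_t P1 `|` scale_fset (1 - 'X_t) P2) f /\ f \in polys X <->
  alg_cone X Z1 P1 f /\ alg_cone X Z2 P2 f.
Proof.
move=> tX Z1X P1X Z2X P2X; split=> [[fC fX]|[f1 f2]]; last first.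
  split; last exact: alg_cone_polys f1.
  have -> : f = 'X_t * f + (1 - 'X_t) * f by rewrite -mulrDl subrKC mul1r.
  have sXY := subsetUr [set t] X; apply: alg_coneD.
    apply: (alg_cone_scale_fset sXY) f1; exact/fsubsetP/fsubsetUl.
  apply: (alg_cone_scale_fset sXY) f2; exact/fsubsetP/fsubsetUr.
have subst1BX q : (1 - 'X_t) \mPo subst_var t q = 1 - q.
  by rewrite rmorphB rmorph1 /= subst_varX.
split; last rewrite fsetUC [X in alg_cone _ _ X]fsetUC in fC.
- apply: (alg_cone_subst_var (q := 1)) fX fC; rewrite ?rpred1 ?subst_varX //.
  by rewrite subst1BX subrr.
- apply: (alg_cone_subst_var (q := 0)) fX fC; rewrite ?rpred0 ?subst_varX //.
  by rewrite subst1BX subr0.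
Qed.

Lemma scale_fset_var_polys X t Z1 Z2 :
  {subset Z1 <= polys X} -> {subset Z2 <= polys X} ->
  {subset scale_fset 'X_t Z1 `|` scale_fset (1 - 'X_t) Z2
    <= polys (t |: X)%SET}.
Proof.
move=> Z1X Z2X; have sXY := polysS (subsetUr [set t] X).
have tY : ('X_t : {mpoly rat[n]}) \in polys (t |: X)%SET.
  by rewrite mpolyX_polys monosU setU11.
by apply: scale_fsetU_polys; rewrite ?rpredB ?rpred1 // => z; auto.
Qed.

End AlgebraicCones.

Theorem theorem3p11 (n : nat) (X : {set 'I_n}) (t : 'I_n)
    (Z1 P1 Z2 P2 : {fset {mpoly rat[n]}})
    (le : rel 'X_{1..n}) (Z P : {fset {mpoly rat[n]}}) :
  t \notin X ->
  {subset Z1 <= polys X} -> {subset P1 <= polys X} ->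
  {subset Z2 <= polys X} -> {subset P2 <= polys X} ->
  monomial_order (t |: X) le ->
  is_intersect le X t Z1 P1 Z2 P2 (Z, P) ->
  forall f : {mpoly rat[n]},
    alg_cone X Z P f <-> alg_cone X Z1 P1 f /\ alg_cone X Z2 P2 f.
Proof.
move=> tX Z1X P1X Z2X P2X leP inter f.
rewrite -(alg_cone_intersect f tX Z1X P1X Z2X P2X).
exact: (project_alg_cone f (subsetUr _ _) leP (scale_fset_var_polys Z1X Z2X)
  (scale_fset_var_polys P1X P2X) inter).
Qed.
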